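(* Let $\mathfrak{U}=[0,1]$, let $U$ be a random variable with values in $[0,1]$ and non-atomic law, let $n\ge 1$ be an integer, and let $\varepsilon$ be a real random variable with mean $0$ and finite variance. Let $\mathcal{B}$ and $\mathcal{C}$ be admissible partitions of $[0,1]$ (with respect to the same $n$) that are both monotone, and let $\mathcal{C}\le_{\mathrm{ref.}}\mathcal{B}$ (that is, $\mathcal{B}$ is a refinement of $\mathcal{C}$). If $f:[0,1]\to\mathbb{R}$ is non-decreasing, then $$W_{\mathrm{IE}}^{\mathcal{B}}\le_{\mathrm{cx}}W_{\mathrm{IE}}^{\mathcal{C}}.$$
   Context: Fix $n$ and let $N=\{1,\dots,n\}$. An admissible partition of $\mathfrak{U}$ is a finite sequence $\mathcal{B}=(B_1,\dots,B_b)$ of pairwise disjoint measurable sets with union $\mathfrak{U}$ such that $\mathbb{P}(U\in B_i)=k_i/n$ with $k_i\in\{1,\dots,n\}$ and $\sum_i k_i=n$. A partition $\mathcal{B}^*=(B_1^*,\dots,B_b^* )$ of $N$ is associated to $\mathcal{B}$ if $|B_i^*|=k_i$ for all $i$; each admissible $\mathcal{B}$ is taken together with an associated $\mathcal{B}^*$, and for $B=B_i\in\mathcal{B}$ one writes $B^*=B_i^*$, so that $\mathbb{P}(U\in B)=|B^*|/n$. (The laws of the estimators below do not depend on which associated partition is chosen.) For subsets $G,H$ of the real line, $G\le H$ means $g\le h$ for every $g\in G$ and $h\in H$. The partition $\mathcal{B}=(B_1,\dots,B_b)$ of $[0,1]$ is monotone if $B_1\le\cdots\le B_b$. $\mathcal{C}\le_{\mathrm{ref.}}\mathcal{B}$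 means that every set in $\mathcal{C}$ is a union of sets in $\mathcal{B}$. For $B\in\mathcal{B}$, $P_{U|B}$ denotes the conditional law of $U$ given $U\in B$. Let $\{V_j^B: j\in B^*, B\in\mathcal{B}\}$ be independent random variables with $V_j^B$ having law $P_{U|B}$, and let $\varepsilon_1,\dots,\varepsilon_n$ be independent copies of $\varepsilon$, independent of the variables $V_j^B$. Define $$W_{\mathrm{IE}}^{\mathcal{B}}=\frac1n\sum_{B\in\mathcal{B}}\sum_{j\in B^*}\bigl(f(V_j^B)+\varepsilon_j\bigr),$$ and define $W_{\mathrm{IE}}^{\mathcal{C}}$ in the same way from $\mathcal{C}$. For integrable real random variables, $Y\le_{\mathrm{cx}}X$ means $\mathbb{E}[\phi(Y)]\le\mathbb{E}[\phi(X)]$ for all convex $\phi:\mathbb{R}\to\mathbb{R}$ (expectations being well defined in $(-\infty,\infty]$). *)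

(* Defs.v *)
From HB Require Import structures.
From mathcomp Require Import all_boot all_order all_algebra.
From mathcomp Require Import all_classical all_reals all_analysis.

Set Implicit Arguments.
Unset Strict Implicit.
Unset Printing Implicit Defensive.

Import Order.TTheory GRing.Theory Num.Theory.
Import numFieldNormedType.Exports.

Local Open Scope classical_set_scope.
Local Open Scope ring_scope.

(* Real-valued random variables; the carrier of a measurable space of values
   inside [0,1] is rendered by R itself together with an explicit range
   condition, and a function on [0,1] by a function on R of which only the
   values on [0,1] matter. *)

Definition non_atomic d (T : measurableType d) (R : realType)
    (mu : set T -> \bar R) : Prop :=
  forall A, measurable A -> (0 < mu A)%E ->
    exists B, [/\ measurable B, B `<=` A, (0 < mu B)%E & (mu B < mu A)%E].

(* Mutual independence: the product rule over every (finite) subfamily. *)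
Definition mutually_independent d (T : measurableType d) (R : realType)
    (P : probability T R) (I : finType) (X : I -> {RV P >-> R}) : Prop :=
  forall (J : {set I}) (A : I -> set R), (forall i, measurable (A i)) ->
    P (\bigcap_(i in [set` J]) (X i @^-1` A i)) =
    (\prod_(i in J) P (X i @^-1` A i))%E.

Definition same_law d1 (T1 : measurableType d1) d2 (T2 : measurableType d2)
    (R : realType) (P1 : probability T1 R) (P2 : probability T2 R)
    (X1 : {RV P1 >-> R}) (X2 : {RV P2 >-> R}) : Prop :=
  forall A : set R, measurable A ->
    distribution P1 X1 A = distribution P2 X2 A.

(* P_{U|B}(A) = P(U \in A, U \in B) / P(U \in B); only used when
   P(U \in B) > 0. *)
Definition cond_law d (T : measurableType d) (R : realType)
    (P : probability T R) (U : {RV P >-> R}) (B : set R) (A : set R) : \bar R :=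
  (distribution P U (A `&` B) / distribution P U B)%E.

Definition convex_order d1 (T1 : measurableType d1) d2 (T2 : measurableType d2)
    (R : realType) (P1 : probability T1 R) (P2 : probability T2 R)
    (Y : T1 -> R) (X : T2 -> R) : Prop :=
  [/\ P1.-integrable setT (EFin \o Y), P2.-integrable setT (EFin \o X) &
      forall phi : R -> R, convex_function [set: R] phi ->
        ('E_P1[phi \o Y] <= 'E_P2[phi \o X])%E].

(* The sequence (B_1, ..., B_b) is a function on 'I_b, and k i is the integer
   such that P(U \in B_i) = k_i / n. *)
Definition admissible d (T : measurableType d) (R : realType)
    (P : probability T R) (U : {RV P >-> R}) (n b : nat)
    (B : 'I_b -> set R) (k : 'I_b -> nat) : Prop :=
  [/\ forall i, measurable (B i),
      trivIset [set: 'I_b] B,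
      \bigcup_i B i = `[0, 1]%classic,
      forall i, (1 <= k i <= n)%N /\
        P (U @^-1` B i) = ((k i)%:R / n%:R)%:E
    & (\sum_(i < b) k i)%N = n].

(* N = {1, ..., n} is 'I_n. *)
Definition associated (n b : nat) (k : 'I_b -> nat)
    (Bs : 'I_b -> {set 'I_n}) : Prop :=
  [/\ forall i j, i != j -> (Bs i :&: Bs j)%SET = finset.set0,
      forall l, exists i, l \in Bs i
    & forall i, #|Bs i| = k i].

Definition set_le (R : realType) (G H : set R) : Prop :=
  forall g h, G g -> H h -> g <= h.

Definition monotone_partition (R : realType) (b : nat) (B : 'I_b -> set R) :=
  forall i j : 'I_b, (i < j)%N -> set_le (B i) (B j).

Definition coarser (R : realType) (c b : nat)
    (C : 'I_c -> set R) (B : 'I_b -> set R) : Prop :=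
  forall i, exists J : set 'I_b, C i = \bigcup_(j in J) B j.

(* V and e realize, on a probability space (T', Q), the variables
   V_j^B (j \in B^*, B in the partition) and eps_1, ..., eps_n.  As the B^*
   partition N, the index j alone determines the block, so V is indexed by j.
   The V_j^B are [0,1]-valued. *)
Definition IE_sample d (T : measurableType d) (R : realType)
    (P : probability T R) (U eps : {RV P >-> R}) (n b : nat)
    (B : 'I_b -> set R) (Bs : 'I_b -> {set 'I_n})
    d' (T' : measurableType d') (Q : probability T' R)
    (V e : 'I_n -> {RV Q >-> R}) : Prop :=
  [/\ forall j w, V j w \in `[0, 1]%R,
      forall i j, j \in Bs i -> forall A, measurable A ->
        distribution Q (V j) A = cond_law U (B i) A,
      forall j, same_law (e j) eps
    & mutually_independent
        (fun s : 'I_n + 'I_n =>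
           match s with inl j => V j | inr j => e j end)].

Definition W_IE (R : realType) (f : R -> R) (n b : nat)
    (Bs : 'I_b -> {set 'I_n}) (T' : Type) (V e : 'I_n -> T' -> R) (w : T') : R :=
  n%:R^-1 * \sum_(i < b) \sum_(j in Bs i) (f (V j w) + e j w).

(* Main.v *)
Require Import Defs.
From HB Require Import structures.
From mathcomp Require Import all_boot all_order all_algebra.
From mathcomp Require Import all_classical all_reals all_analysis.
From mathcomp Require Import measurable_realfun zify ring lra.

Set Implicit Arguments.
Unset Strict Implicit.
Unset Printing Implicit Defensive.

Import Order.TTheory GRing.Theory Num.Theory.
Import numFieldNormedType.Exports.

Local Open Scope classical_set_scope.
Local Open Scope ring_scope.

(** The noise is an independent summand with the same law in both estimators. For
    nonnegative convex [phi], independence turns [E phi(W)] into iterated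
    integrals: first over the [V_j], then over the [eps_j]. The noise integrals
    are monotone and the same for both estimators, so it is enough to compare,
    for every convex [phi] and every shift [y], the numbers
    [E phi(y + sum_j f(V_j)/n)]. These are obtained from [phi] by composing the
    averaging operators
    [(T_A phi)(y) = E(phi(y + g(U)) | U in A)], with [g = f/n], one factor for
    each index [j].

    On convex functions the [T_A] commute (Fubini), are monotone and additive,
    and preserve convexity, so only the multiset of blocks matters, and it is
    enough to merge two blocks [A], [B], where [A] lies before [B], that carry
    [k1] and [k2] indices. Put [m = k1 + k2] and
    [G l = (T_B^l T_A^(m-l) phi)(y)]. As [g] is nondecreasing, [g <= g'] whenever
    [g] is a value on [A] and [g'] a value on [B]; convexity of [phi] makes
    [T_B phi - T_A phi] nondecreasing, hence
    [T_A T_B phi + T_B T_A phi <= T_A T_A phi + T_B T_B phi]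
    ([average_four_points]) and [G] is a convex sequence. The operator of the
    union is the mixture [T_(A u B) = (k1/m) T_A + (k2/m) T_B], so
    [T_(A u B)^m phi] averages [G] over a binomial law of mean [k2], and Jensen's
    inequality bounds it below by [G k2] ([merge_two]). Repeating this along the
    sorted list of blocks inside each set of the coarser partition gives
    [averages_refine].

    A convex [phi] of arbitrary sign is a nonnegative convex function plus an
    affine one. The affine part has the same finite expectation for both
    estimators, since the comparison of the averages applies to [z] and to [-z];
    the expectation of the sum splits even when that of the nonnegative part is
    infinite ([expectation_add_integrable]). *)

(** * Convex functions on the line *)

Definition cvx (R : realType) (phi : R -> R) : Prop :=
  forall t x y : R, 0 <= t <= 1 ->
    phi (t * x + (1 - t) * y) <= t * phi x + (1 - t) * phi y.

Lemma convex_function_cvx (R : realType) (phi : R -> R) :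
  convex_function [set: R] phi -> cvx phi.
Proof.
move=> cphi t x y t01.
have := cphi (Itv01 (andP t01).1 (andP t01).2) x y.
by rewrite !inE => /(_ Logic.I Logic.I).
Qed.

Section convex.
Context {R : realType}.
Implicit Types phi psi : R -> R.

(** Convexity with unnormalised weights, which spares the divisions when the
    weights are lengths of intervals. *)
Lemma cvx_combination phi (a b u w x : R) : cvx phi ->
  0 <= a -> 0 <= b -> 0 < a + b -> (a + b) * x = a * u + b * w ->
  (a + b) * phi x <= a * phi u + b * phi w.
Proof.
move=> cphi a0 b0 ab0 e.
have -> : x = a / (a + b) * u + (1 - a / (a + b)) * w.
  apply: (mulfI (lt0r_neq0 ab0)); rewrite e; field; exact: lt0r_neq0.
have t01 : 0 <= a / (a + b) <= 1.
  rewrite divr_ge0 ?(ltW ab0)//= ler_pdivrMr// mul1r; lra.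
have := cphi _ u w t01; rewrite -(ler_pM2l ab0) => /le_trans; apply.
rewrite le_eqVlt; apply/orP; left; apply/eqP; field; exact: lt0r_neq0.
Qed.

Lemma cvxD phi psi : cvx phi -> cvx psi -> cvx (fun x => phi x + psi x).
Proof.
move=> cphi cpsi t x y t01; have := cphi t x y t01; have := cpsi t x y t01; lra.
Qed.

Lemma cvx_affine (a b : R) : cvx (fun x => a * x + b).
Proof. by move=> t x y _; rewrite le_eqVlt; apply/orP; left; apply/eqP; ring. Qed.

(** Both inner points lie in the interval between the outer ones and have the
    same sum as these, so the weights that express one of them as a convex
    combination of the outer points express the other when exchanged. *)
Lemma cvx_four_points phi (y y' x x' : R) : cvx phi -> y <= y' -> x <= x' ->
  phi (y' + x) + phi (y + x') <= phi (y' + x') + phi (y + x).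
Proof.
move=> cphi yy xx.
have [e|ne] := eqVneq (y + x) (y' + x').
  have -> : y' = y by lra.
  by rewrite addrC.
have d0 : 0 < (y' - y) + (x' - x).
  rewrite lt0r; apply/andP; split; last by lra.
  by apply: contra_neq ne => ?; lra.
have h1 := @cvx_combination phi (y' - y) (x' - x) (y' + x') (y + x) (y' + x) cphi.
have h2 := @cvx_combination phi (x' - x) (y' - y) (y' + x') (y + x) (y + x') cphi.
have {}h1 : _ := h1 ltac:(lra) ltac:(lra) d0 ltac:(ring).
have {}h2 : _ := h2 ltac:(lra) ltac:(lra) ltac:(lra) ltac:(ring).
rewrite -(ler_pM2l d0); nra.
Qed.

(** Sublevel sets of a convex function are intervals. *)
Lemma cvx_measurable phi : cvx phi -> measurable_fun [set: R] phi.
Proof.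
move=> cphi.
apply: (measurability (@RGenInftyO.G R)) => [|/= _ [_] [r] -> <-].
  exact: RGenInftyO.measurableE.
rewrite setTI; apply: is_interval_measurable => s t/=.
rewrite !in_itv/= => fs ft u /andP[su ut].
rewrite in_itv/=.
have [e|ne] := eqVneq s t.
  by have -> : u = s by lra.
have d0 : 0 < (t - u) + (u - s) by have : s < t; [rewrite lt_neqAle ne; lra|lra].
have := @cvx_combination phi (t - u) (u - s) s t u cphi ltac:(lra) ltac:(lra) d0 ltac:(ring).
move=> h; rewrite -(ltr_pM2l d0); apply: (le_lt_trans h).
have [e|tu] := eqVneq t u; first by rewrite -e in d0 *; nra.
have : 0 < t - u by rewrite subr_gt0 lt_neqAle eq_sym tu.
nra.
Qed.

(** The chord bounds [phi] from above on [-M, M]; reflection through the origin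
    turns this into a lower bound. *)
Lemma cvx_bounded_itv phi (M : R) : cvx phi ->
  exists K, forall x, `|x| <= M -> `|phi x| <= K.
Proof.
move=> cphi.
exists (`|phi M| + `|phi (- M)| + 2 * `|phi 0|) => x.
rewrite ler_norml => /andP[Mx xM].
have [M0|M0] := leP M 0.
  have -> : x = M by lra.
  have := normr_ge0 (phi (-M)); have := normr_ge0 (phi 0); lra.
have up z : - M <= z -> z <= M -> phi z <= `|phi M| + `|phi (- M)|.
  move=> Mz zM.
  have := @cvx_combination phi (z + M) (M - z) M (- M) z cphi
    ltac:(lra) ltac:(lra) ltac:(lra) ltac:(ring).
  have := ler_norm (phi M); have := ler_norm (phi (- M)).
  have := normr_ge0 (phi M); have := normr_ge0 (phi (- M)).
  move=> ? ? ? ? ?; have d0 : 0 < (z + M) + (M - z) by lra.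
  rewrite -(ler_pM2l d0); nra.
have := up _ Mx xM.
have := @cvx_combination phi 1 1 x (- x) 0 cphi ltac:(lra) ltac:(lra) ltac:(lra) ltac:(ring).
have := up (- x) ltac:(lra) ltac:(lra).
have := ler_norm (- phi 0); rewrite normrN.
rewrite ler_norml; have := normr_ge0 (phi 0).
by move=> *; apply/andP; split; lra.
Qed.

(** The slope of a supporting line at [0] is the supremum of the slopes of the
    chords that end at [0]. *)
Lemma cvx_affine_minorant phi : cvx phi ->
  exists a b : R, forall x, a * x + b <= phi x.
Proof.
move=> cphi.
pose S := [set (phi 0 - phi (- t)) / t | t in [set t : R | 0 < t]].
have slope s t : 0 < s -> 0 < t -> (phi 0 - phi (- t)) / t <= (phi s - phi 0) / s.
  move=> s0 t0.
  have := @cvx_combination phi t s s (- t) 0 cphi (ltW t0) (ltW s0)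
    ltac:(lra) ltac:(ring).
  by rewrite ler_pdivrMr// mulrAC ler_pdivlMr//; nra.
have S0 : S !=set0 by exists ((phi 0 - phi (- 1)) / 1); exists 1 => //=.
have Sub : has_ubound S.
  by exists ((phi 1 - phi 0) / 1) => _ [t /= t0 <-]; exact: slope.
exists (sup S), (phi 0) => x.
have [x0|x0|->] := ltgtP x 0; last by rewrite mulr0 add0r.
- have : (phi 0 - phi x) / (- x) <= sup S.
    apply: ub_le_sup => //; exists (- x) => /=; first by rewrite oppr_gt0.
    by rewrite opprK.
  by rewrite ler_pdivrMr ?oppr_gt0//; lra.
- have : sup S <= (phi x - phi 0) / x.
    by apply: ge_sup => // _ [t /= t0 <-]; exact: slope.
  by rewrite ler_pdivlMr//; lra.
Qed.

End convex.

(** * Averaging a convex function over a random increment *)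

Section average.
Context d (T : measurableType d) (R : realType) (mu : probability T R).
Variable g : T -> R.
Hypothesis mg : measurable_fun setT g.
Variable K : R.
Hypothesis gK : forall x, `|g x| <= K.
Implicit Types (A B : set T) (phi psi : R -> R).

Definition mass A : R := fine (mu A).

(** The conditional expectation of [phi (y + g)] given [A]; it is the action on
    [phi] of an independent increment distributed as [g] given [A]. *)
Definition average A phi (y : R) : R :=
  (\int[mu]_(x in A) phi (y + g x)) / mass A.

Lemma massE A : measurable A -> mu A = (mass A)%:E.
Proof. by move=> mA; rewrite /mass fineK// fin_num_measure. Qed.

(** The values [y + g x] stay in a bounded interval, where [phi] is bounded. *)
Lemma cvx_integrable phi A y : cvx phi -> measurable A ->
  mu.-integrable A (EFin \o (fun x => phi (y + g x))).
Proof.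
move=> cphi mA; apply: measurable_bounded_integrable => //.
- by rewrite -ge0_fin_numE ?measure_ge0 ?fin_num_measure.
- apply: (measurable_funS measurableT) => //.
  apply: (measurableT_comp (cvx_measurable cphi)).
  exact: measurable_funD.
- have [M phiM] := cvx_bounded_itv (`|y| + K) cphi.
  exists M; split; first exact: num_real.
  move=> z Mz x _ /=; apply: le_trans (ltW Mz); apply: phiM.
  by apply: le_trans (ler_normD _ _) _; rewrite lerD2l.
Qed.

Lemma average_le A phi psi y : measurable A -> cvx phi -> cvx psi ->
  (forall z, phi z <= psi z) -> average A phi y <= average A psi y.
Proof.
move=> mA cphi cpsi le; rewrite /average ler_wpM2r ?invr_ge0 ?fine_ge0//.
by apply: le_Rintegral => //; exact: cvx_integrable.
Qed.

Lemma Rintegral_cvx A phi : measurable A -> cvx phi ->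
  cvx (fun y => \int[mu]_(x in A) phi (y + g x)).
Proof.
move=> mA cphi t x y t01.
have i z := cvx_integrable z cphi mA.
have iZ a z : mu.-integrable A (EFin \o (fun u => a * phi (z + g u))).
  have := integrableZl mA a (i z).
  by apply: eq_integrable => // u _; rewrite /= EFinM.
rewrite -!RintegralZl// -RintegralD//; apply: le_Rintegral => //.
- have := integrableD mA (iZ t x) (iZ (1 - t) y).
  by apply: eq_integrable => // u _; rewrite /= EFinD.
- move=> u _; have := cphi t (x + g u) (y + g u) t01.
  by congr (phi _ <= _); ring.
Qed.

Lemma average_cvx A phi : measurable A -> cvx phi -> cvx (average A phi).
Proof.
move=> mA cphi t x y t01; rewrite /average.
rewrite !mulrA -mulrDl ler_wpM2r ?invr_ge0 ?fine_ge0//.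
exact: (Rintegral_cvx mA cphi).
Qed.

Lemma averageD A phi psi y : measurable A -> cvx phi -> cvx psi ->
  average A (fun z => phi z + psi z) y = average A phi y + average A psi y.
Proof.
move=> mA cphi cpsi.
by rewrite /average RintegralD ?mulrDl//; exact: cvx_integrable.
Qed.

(** The law conditioned on a disjoint union is the mixture of the conditional
    laws. *)
Lemma average_setU A B phi y : measurable A -> measurable B -> cvx phi ->
  [disjoint A & B] -> 0 < mass A -> 0 < mass B ->
  average (A `|` B) phi y =
  mass A / mass (A `|` B) * average A phi y +
  mass B / mass (A `|` B) * average B phi y.
Proof.
move=> mA mB cphi dAB A0 B0.
rewrite /average Rintegral_setU//; last first.
  by apply: cvx_integrable => //; exact: measurableU.
have -> : mass (A `|` B) = mass A + mass B.
  rewrite /mass measureU//; last by apply/eqP; rewrite -disj_set2E.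
  by rewrite fineD// fin_num_measure.
field; lra.
Qed.

Lemma Rintegral_swap A B (h : T -> T -> R) (M : R) :
  measurable A -> measurable B ->
  measurable_fun setT (fun z : T * T => h z.1 z.2) ->
  (forall x x', `|h x x'| <= M) ->
  \int[mu]_(x in A) \int[mu]_(x' in B) h x x' =
  \int[mu]_(x' in B) \int[mu]_(x in A) h x x'.
Proof.
move=> mA mB mh hM.
pose f := fun z : T * T => h z.1 z.2 * (\1_A z.1 * \1_B z.2) : R.
have mf : measurable_fun setT f.
  apply: measurable_funM => //; apply: measurable_funM.
    exact: (measurableT_comp (measurable_indic mA) measurable_fst).
  exact: (measurableT_comp (measurable_indic mB) measurable_snd).
have fM z : `|f z| <= M.
  rewrite /f !indicE; case: (_ \in _); case: (_ \in _);
    rewrite !(mulr1, mulr0, mul0r)// normr0;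
    exact: le_trans (normr_ge0 _) (hM z.1 z.2).
have iE (k : T -> R) : measurable_fun setT k -> (forall x, `|k x| <= M) ->
    mu.-integrable setT (EFin \o k).
  move=> mk kM; apply: measurable_bounded_integrable => //.
    by rewrite -ge0_fin_numE ?measure_ge0 ?fin_num_measure.
  exists M; split; first exact: num_real.
  by move=> z Mz x _ /=; exact: le_trans (kM x) (ltW Mz).
have if1 x : mu.-integrable setT (EFin \o (fun x' => f (x, x'))).
  by apply: iE => [|x']//; exact: measurableT_comp.
have if2 x' : mu.-integrable setT (EFin \o (fun x => f (x, x'))).
  by apply: iE => [|x]//; exact: measurableT_comp.
have E1 : \int[mu]_(x in A) \int[mu]_(x' in B) h x x' =
    fine (\int[mu]_x \int[mu]_x' (f (x, x'))%:E)%E.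
  rewrite Rintegral_mkcond; congr fine; apply: eq_integral => x _.
  rewrite -[RHS]fineK; last exact: integrable_fin_num (if1 x).
  congr EFin; rewrite patchE; case: ifPn => xA; last first.
    rewrite /f/= indicE (negPf xA).
    under eq_integral do rewrite mul0r mulr0.
    by rewrite integral0.
  rewrite Rintegral_mkcond; congr fine; apply: eq_integral => x' _ /=.
  rewrite patchE /f/= !indicE xA mul1r.
  by case: ifPn => _; rewrite ?mulr1 ?mulr0.
have E2 : \int[mu]_(x' in B) \int[mu]_(x in A) h x x' =
    fine (\int[mu]_x' \int[mu]_x (f (x, x'))%:E)%E.
  rewrite Rintegral_mkcond; congr fine; apply: eq_integral => x' _.
  rewrite -[RHS]fineK; last exact: integrable_fin_num (if2 x').
  congr EFin; rewrite patchE; case: ifPn => xB; last first.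
    rewrite /f/= !indicE (negPf xB).
    under eq_integral do rewrite !mulr0.
    by rewrite integral0.
  rewrite Rintegral_mkcond; congr fine; apply: eq_integral => x _ /=.
  rewrite patchE /f/= !indicE xB mulr1.
  by case: ifPn => _; rewrite ?mulr1 ?mulr0.
rewrite E1 E2; congr fine.
have muT : mu setT = 1%E := probability_setT mu.
have if12 : (mu \x mu)%E.-integrable setT (EFin \o f).
  apply/integrable12ltyP; first exact/measurable_EFinP.
  apply: (@le_lt_trans _ _ (\int[mu]_x (cst M%:E x))%E).
    apply: ge0_le_integral => //.
    - by move=> x _; apply: integral_ge0.
    - apply: (measurable_fun_fubini_tonelli_F (fun z => `|(f z)%:E|%E)) => //.
      by apply: measurableT_comp => //; exact/measurable_EFinP.
    - move=> x _ /=.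
      apply: (@le_trans _ _ (\int[mu]_x' (cst M%:E x'))%E).
        apply: ge0_le_integral => //.
        + by apply/measurable_EFinP/measurableT_comp => //; exact: measurableT_comp.
        + by move=> x' _; rewrite lee_fin fM.
      by rewrite integral_cst// [X in (_ * X)%E]muT mule1.
  by rewrite integral_cst// [X in (_ * X)%E]muT mule1 ltry.
exact: (Fubini if12).
Qed.

(** The two increments enter through their sum, so the order of integration is
    immaterial. *)
Lemma averageC A B phi y : measurable A -> measurable B -> cvx phi ->
  average A (average B phi) y = average B (average A phi) y.
Proof.
move=> mA mB cphi; rewrite /average.
have [M phiM] := cvx_bounded_itv (`|y| + K + K) cphi.
have hM x x' : `|phi (y + g x + g x')| <= M.
  apply: phiM; apply: le_trans (ler_normD _ _) _; rewrite lerD//.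
  by apply: le_trans (ler_normD _ _) _; rewrite lerD2l.
rewrite !RintegralZr//;
  [|exact: (cvx_integrable _ (Rintegral_cvx _ _) _)..].
rewrite mulrAC; congr (_ / _ / _).
rewrite (Rintegral_swap (h := fun x x' => phi (y + g x + g x')) (M := M))//.
  by apply: eq_Rintegral => x' _; apply: eq_Rintegral => x _; rewrite addrAC.
apply: (measurableT_comp (cvx_measurable cphi)).
by apply: measurable_funD; [apply: measurable_funD => //|];
  apply: (measurableT_comp mg).
Qed.

(** Any value taken on [B] separates the two means: it dominates the mean over
    [A], and this bound may then be averaged over [B]. *)
Lemma Rintegral_sep A B (F : T -> R) : measurable A -> measurable B ->
  0 < mass A -> 0 < mass B ->
  mu.-integrable A (EFin \o F) -> mu.-integrable B (EFin \o F) ->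
  (forall x x', A x -> B x' -> F x <= F x') ->
  (\int[mu]_(x in A) F x) / mass A <= (\int[mu]_(x in B) F x) / mass B.
Proof.
move=> mA mB A0 B0 iA iB AB.
have ic D c : measurable D -> mu.-integrable D (EFin \o cst c).
  by move=> mD; exact: finite_measure_integrable_cst.
rewrite ler_pdivlMr// -Rintegral_cst//; apply: le_Rintegral => //.
  exact: ic.
move=> x' Bx'; rewrite ler_pdivrMr// -Rintegral_cst//.
by apply: le_Rintegral => // [|x Ax]; [exact: ic|exact: AB].
Qed.

(** [psi = average B phi - average A phi] is nondecreasing: for [y <= y'] the
    increment [phi (y' + u) - phi (y + u)] is nondecreasing in [u], so its mean
    over [B] exceeds that over [A]. For the same reason the mean of [psi] over [B]
    exceeds that over [A], which is the claim. *)
Lemma average_four_points A B phi y : measurable A -> measurable B ->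
  0 < mass A -> 0 < mass B -> (forall x x', A x -> B x' -> g x <= g x') ->
  cvx phi ->
  average A (average B phi) y + average B (average A phi) y <=
  average A (average A phi) y + average B (average B phi) y.
Proof.
move=> mA mB A0 B0 AB cphi.
have cA := average_cvx mA cphi; have cB := average_cvx mB cphi.
have iD D p q z z' : measurable D -> cvx p -> cvx q ->
    mu.-integrable D (EFin \o (fun x => p (z + g x) - q (z' + g x))).
  move=> mD cp cq.
  have := integrableB mD (cvx_integrable z cp mD) (cvx_integrable z' cq mD).
  by apply: eq_integrable.
have nd z z' : z <= z' ->
    average B phi z - average A phi z <= average B phi z' - average A phi z'.
  move=> zz'.
  have := Rintegral_sep mA mB A0 B0 (iD A phi phi z' z mA cphi cphi)
    (iD B phi phi z' z mB cphi cphi).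
  rewrite !RintegralB ?mulrBl//; try exact: cvx_integrable.
  rewrite -!/(average _ _ _) => h.
  suff: average A phi z' - average A phi z <= average B phi z' - average B phi z.
    lra.
  apply: h => x x' Ax Bx'.
  have := cvx_four_points cphi zz' (AB _ _ Ax Bx'); lra.
have := Rintegral_sep mA mB A0 B0 (iD A _ _ y y mA cB cA)
  (iD B _ _ y y mB cB cA).
rewrite !RintegralB ?mulrBl//; try exact: cvx_integrable.
rewrite -!/(average _ _ _) => h.
suff: average A (average B phi) y - average A (average A phi) y <=
  average B (average B phi) y - average B (average A phi) y by lra.
by apply: h => x x' Ax Bx'; apply: nd; rewrite lerD2l AB.
Qed.

End average.

(** * Merging two adjacent blocks *)

(** The forward difference of [G] at [k] is the slope of a supporting line,
    because the differences of a convex sequence increase. *)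
Lemma discrete_support_line (R : realFieldType) (G : nat -> R) (m k : nat) :
  (forall l, (l.+1 < m)%N -> G l.+1 + G l.+1 <= G l + G l.+2) ->
  (k < m)%N -> forall l, (l <= m)%N ->
  G k + (G k.+1 - G k) * (l%:R - k%:R) <= G l.
Proof.
move=> cG km l lm.
have incr i j : (i <= j)%N -> (j < m)%N -> G i.+1 - G i <= G j.+1 - G j.
  elim: j => [|j IH]; first by rewrite leqn0 => /eqP ->.
  rewrite leq_eqVlt => /predU1P[->//|ij jm].
  by have := IH ij (ltnW jm); have := cG j jm; lra.
have [kl|/ltnW lk] := leqP k l.
  have [t e] : exists t, l = (k + t)%N by exists (l - k)%N; lia.
  rewrite {}e in lm kl *; elim: t lm {kl} => [|t IH] lm.
    by rewrite addn0 subrr mulr0 addr0.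
  have := IH ltac:(lia); have := incr k (k + t)%N ltac:(lia) ltac:(lia).
  by rewrite addnS !natrD -natr1; lra.
have [t e] : exists t, k = (l + t)%N by exists (k - l)%N; lia.
suff : forall t, (l + t <= k)%N -> G (l + t)%N - G l <= (G k.+1 - G k) * t%:R.
  have ek : k%:R = l%:R + t%:R :> R by rewrite e natrD.
  by move=> /(_ t ltac:(lia)); rewrite -e ek; nra.
clear t e; move=> t; elim: t => [_|t IH ltk]; first by rewrite addn0 subrr mulr0.
have := IH ltac:(lia); have := incr (l + t)%N k ltac:(lia) ltac:(lia).
by rewrite addnS -natr1; lra.
Qed.

Section composition.
Context d (T : measurableType d) (R : realType) (mu : probability T R).
Variable g : T -> R.
Hypothesis mg : measurable_fun setT g.
Variable K : R.
Hypothesis gK : forall x, `|g x| <= K.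
Variables (I : eqType) (A : I -> set T).
Hypothesis mA : forall i, measurable (A i).
Implicit Types (phi psi : R -> R) (s t r : seq I).

(** The expectation of [phi (y + X_1 + ... + X_r)] for independent increments
    [X_i] distributed as [g] given [A i], for [i] in the list. *)
Definition averages s phi : R -> R := foldr (fun i => average mu g (A i)) phi s.

Lemma averages_cat s t phi :
  averages (s ++ t) phi = averages s (averages t phi).
Proof. exact: foldr_cat. Qed.

Lemma averages_cvx s phi : cvx phi -> cvx (averages s phi).
Proof. by move=> cphi; elim: s => //= i s IH; exact: average_cvx. Qed.

Lemma averages_le s phi psi : cvx phi -> cvx psi ->
  (forall y, phi y <= psi y) -> forall y, averages s phi y <= averages s psi y.
Proof.
move=> cphi cpsi le; elim: s => //= i s IH y.
by apply: (average_le _ mg gK) => //; exact: averages_cvx.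
Qed.

Lemma averages_ge0 s phi : (forall y, 0 <= phi y) -> forall y, 0 <= averages s phi y.
Proof.
move=> phi0; elim: s => //= i s IH y; apply: divr_ge0; last exact: fine_ge0.
by apply: Rintegral_ge0 => x _; exact: IH.
Qed.

Lemma averagesD s phi psi y : cvx phi -> cvx psi ->
  averages s (fun z => phi z + psi z) y = averages s phi y + averages s psi y.
Proof.
move=> cphi cpsi; elim: s y => //= i s IH y.
by rewrite (funext IH) (averageD _ mg gK)//; exact: averages_cvx.
Qed.

(** Commuting [average] past one factor at a time needs the remaining composite
    to be convex, which [averages_cvx] supplies. *)
Lemma averages_front i s t phi : cvx phi ->
  averages (s ++ i :: t) phi = averages (i :: s ++ t) phi.
Proof.
move=> cphi; elim: s => //= j s ->; apply/funext => y /=.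
by apply: averageC => //; rewrite -/(averages _ _); exact: averages_cvx.
Qed.

Lemma averages_perm s t phi : cvx phi -> perm_eq s t ->
  averages s phi = averages t phi.
Proof.
move=> cphi; elim: s t => [|i s IH] t; first by move/perm_size/esym/size0nil ->.
move=> st; have it : i \in t by rewrite -(perm_mem st) mem_head.
case/splitPr: it st => t1 t2.
rewrite perm_sym perm_catC /= perm_cons perm_catC perm_sym => st.
by rewrite averages_front//= (IH _ st).
Qed.

(** The right-hand side replaces each of the [k1 + k2] increments by one drawn
    from the mixture, hence makes the number of increments taken from [A j] random
    with mean [k2]. As the value [G l] attained with [l] such increments is convex
    in [l], Jensen's inequality makes the expectation larger. The binomial law is
    never written down: a supporting line of [G] at [k2] is carried through one
    mixed factor at a time. *)
Lemma merge_two (i j u : I) (k1 k2 : nat) (c : R) phi y :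
  A u = A i `|` A j -> [disjoint (A i) & (A j)] ->
  (forall x x', A i x -> A j x' -> g x <= g x') ->
  (0 < k1)%N -> (0 < k2)%N -> 0 < c ->
  mass mu (A i) = c * k1%:R -> mass mu (A j) = c * k2%:R -> cvx phi ->
  averages (nseq k1 i ++ nseq k2 j) phi y <= averages (nseq (k1 + k2) u) phi y.
Proof.
move=> Au dij sij k1_gt0 k2_gt0 c0 mi mj cphi.
have i0 : 0 < mass mu (A i) by rewrite mi mulr_gt0// ltr0n.
have j0 : 0 < mass mu (A j) by rewrite mj mulr_gt0// ltr0n.
set m := (k1 + k2)%N.
pose G l := averages (nseq l j ++ nseq (m - l) i) phi y.
(* [GE] moves the two factors that change with [l] next to [phi], where the four
   points inequality applies. *)
have Gconvex l : (l.+1 < m)%N -> G l.+1 + G l.+1 <= G l + G l.+2.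
  move=> lm; pose r := nseq l j ++ nseq (m - l.+2) i.
  have GE p q s : (p + q = 2)%N -> perm_eq s (nseq p j ++ nseq q i) ->
      G (l + p)%N = averages r (averages s phi) y.
    move=> pq ps; rewrite /G -averages_cat; congr (_ y).
    apply: averages_perm => //; apply/permP => a.
    by rewrite !count_cat (permP ps) !count_cat !count_nseq; nia.
  have -> : G l.+2 = averages r (averages [:: j; j] phi) y.
    by rewrite -addn2; exact: (GE 2 0)%N.
  have -> : G l = averages r (averages [:: i; i] phi) y.
    by rewrite -[l]addn0; exact: (GE 0 2)%N.
  have G1 : G l.+1 = averages r (averages [:: j; i] phi) y.
    by rewrite -addn1; exact: (GE 1 1)%N.
  have G1' : G l.+1 = averages r (averages [:: i; j] phi) y.
    by rewrite -addn1; apply: (GE 1 1)%N => //; rewrite (perm_catC [:: i]).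
  rewrite {1}G1' {1}G1 -!averagesD; try exact: averages_cvx.
  apply: averages_le => //; try by apply: cvxD; exact: averages_cvx.
  by move=> z /=; exact: average_four_points.
have k2m : (k2 < m)%N by rewrite /m; lia.
pose sl := G k2.+1 - G k2.
have Gsupp := discrete_support_line Gconvex k2m.
have m0 : (0 : R) < m%:R by rewrite ltr0n; lia.
pose p : R := k2%:R / m%:R.
have ej : c * k2%:R / (c * m%:R) = p.
  by rewrite -mulf_div divff ?mul1r// gt_eqF.
have ei : c * k1%:R / (c * m%:R) = 1 - p.
  rewrite -mulf_div divff ?mul1r ?gt_eqF// /p.
  by apply/eqP; rewrite eq_sym subr_eq -mulrDl -natrD divff// gt_eqF.
have average_merge psi z : cvx psi -> average mu g (A u) psi z =
    (1 - p) * average mu g (A i) psi z + p * average mu g (A j) psi z.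
  move=> cpsi; rewrite Au (average_setU mg gK)//.
  have -> : mass mu (A i `|` A j) = c * m%:R.
    rewrite /mass measureU//; last by apply/eqP; rewrite -disj_set2E.
    by rewrite fineD ?fin_num_measure// -!/(mass _ _) mi mj -mulrDr -natrD.
  by rewrite mi mj ei ej.
clear Au.
(* [q] factors are mixed, [l] come from [A j] and the others from [A i]: the
   expected number of factors from [A j] is [l + q p]. *)
have key q l : (q + l <= m)%N ->
    G k2 + sl * (l%:R + q%:R * p - k2%:R) <=
    averages (nseq q u ++ nseq l j ++ nseq (m - q - l) i) phi y.
  elim: q l => [|q IH] l qlm.
    by rewrite /= subn0 mul0r addr0; exact: Gsupp.
  rewrite /=.
  set r := nseq q u ++ nseq l j ++ nseq (m - q.+1 - l) i.
  have -> : average mu g (A u) (averages r phi) y =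
      (1 - p) * averages (i :: r) phi y + p * averages (j :: r) phi y.
    by apply: average_merge; exact: averages_cvx.
  have -> : averages (i :: r) phi =
      averages (nseq q u ++ nseq l j ++ nseq (m - q - l) i) phi.
    apply: averages_perm => //; apply/permP => a.
    by rewrite /= !count_cat !count_nseq; nia.
  have -> : averages (j :: r) phi =
      averages (nseq q u ++ nseq l.+1 j ++ nseq (m - q - l.+1) i) phi.
    apply: averages_perm => //; apply/permP => a.
    have -> : (m - q - l.+1)%N = (m - q.+1 - l)%N by lia.
    by rewrite -[j :: r]cat1s /r !count_cat !count_nseq /=; nia.
  have := IH l ltac:(lia); have := IH l.+1 ltac:(lia).
  rewrite -natr1 -[q.+1%:R]natr1.
  have p0 : 0 <= p by rewrite divr_ge0.
  have p1 : 0 <= 1 - p by rewrite subr_ge0 ler_pdivrMr// mul1r ler_nat leq_addl.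
  move=> /(ler_wpM2l p0) h1 /(ler_wpM2l p1) h2; nra.
have := key m 0%N; rewrite addn0 subnn !cats0 => /(_ (leqnn _)).
have -> : 0%:R + m%:R * p - k2%:R = 0 by rewrite /p; field; lra.
rewrite mulr0 addr0; apply: le_trans.
rewrite /G /m addnK le_eqVlt; apply/orP; left; apply/eqP; congr (_ y).
by apply: averages_perm => //; rewrite perm_catC.
Qed.

End composition.

(** * Passing to a coarser partition *)

Section refinement.
Context d (T : measurableType d) (R : realType) (mu : probability T R).
Variable g : T -> R.
Hypothesis mg : measurable_fun setT g.
Variable K : R.
Hypothesis gK : forall x, `|g x| <= K.
Variables (b : nat) (B : 'I_b -> set T) (k : 'I_b -> nat) (c : R).
Hypothesis mB : forall i, measurable (B i).
Hypothesis tB : trivIset setT B.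
Hypothesis c0 : 0 < c.
Hypothesis k0 : forall i, (0 < k i)%N.
Hypothesis massB : forall i, mass mu (B i) = c * (k i)%:R.
Hypothesis ordB : forall i j : 'I_b, (i < j)%N ->
  forall x x', B i x -> B j x' -> g x <= g x'.
Implicit Types (phi : R -> R) (s : seq 'I_b).

(** Blocks obtained by merging are labelled by the list of their parts, so that
    multisets of blocks can be compared by counting. *)
Definition union_of s : set T := \big[setU/set0]_(i <- s) B i.

Lemma union_ofP s x : union_of s x <-> exists2 i, i \in s & B i x.
Proof.
rewrite /union_of; elim: s => [|i s IH].
  by rewrite big_nil; split=> // -[].
rewrite big_cons; split=> [[Bix|/IH[j js Bjx]]|[j]].
- by exists i; rewrite ?mem_head.
- by exists j; rewrite // in_cons js orbT.
- by rewrite in_cons => /predU1P[-> ?|js Bjx]; [left|right; apply/IH; exists j].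
Qed.

Lemma measurable_union_of s : measurable (union_of s).
Proof. exact: bigsetU_measurable. Qed.

Lemma blocks_disjoint i j x : B i x -> B j x -> i = j.
Proof. by move=> Bi Bj; apply: tB => //; exists x. Qed.

Lemma union_of_disjoint i s : i \notin s -> [disjoint B i & union_of s].
Proof.
move=> nis; rewrite disj_set2E; apply/eqP; rewrite -subset0 => x [Bi].
by case/union_ofP => j js Bj; move: nis; rewrite (blocks_disjoint Bi Bj) js.
Qed.

Lemma mass_union_of s : uniq s ->
  mass mu (union_of s) = c * (\sum_(i <- s) k i)%:R.
Proof.
elim: s => [_|i s IH /= /andP[nis us]].
  by rewrite /union_of /mass !big_nil measure0 mulr0.
rewrite big_cons natrD mulrDr -massB -(IH us) /union_of big_cons -/(union_of s).
rewrite /mass measureU ?fineD ?fin_num_measure//; try exact: measurable_union_of.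
by apply/eqP; rewrite -disj_set2E; exact: union_of_disjoint.
Qed.

Notation avg := (averages mu g union_of).
Notation split_block s := (flatten [seq nseq (k i) [:: i] | i <- s]).
Notation merged_block s := (nseq (\sum_(i <- s) k i)%N s).

Lemma averages_map (I J : eqType) (A : J -> set T) (L : I -> J) (r : seq I) phi :
  averages mu g A (map L r) phi = averages mu g (A \o L) r phi.
Proof. by elim: r => //= i r ->. Qed.

(** The blocks of [s] are merged one by one from the right: the first block lies
    before the union of the others, so [merge_two] applies to the two. *)
Lemma merge_block s phi y : s != [::] -> pairwise ltn (map val s) -> cvx phi ->
  avg (split_block s) phi y <= avg (merged_block s) phi y.
Proof.
move=> + + cphi; elim: s y => // i s IH y _ /= /andP[ltis ps].
have [->|s0] := eqVneq s [::]; first by rewrite /= big_seq1 cats0.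
have nis : i \notin s.
  by apply/negP => si; have /allP/(_ _ (map_f val si)) := ltis; rewrite /= ltnn.
have us : uniq s.
  by rewrite -(map_inj_uniq val_inj); apply: pairwise_uniq ps; exact: ltnn.
rewrite averages_cat; apply: (@le_trans _ _
    (avg (nseq (k i) [:: i] ++ merged_block s) phi y)).
  rewrite averages_cat; apply: (averages_le _ mg gK).
  - exact: measurable_union_of.
  - by apply: (averages_cvx _ mg gK) => //; exact: measurable_union_of.
  - by apply: (averages_cvx _ mg gK) => //; exact: measurable_union_of.
  - by move=> z; exact: IH.
rewrite big_cons.
apply: (merge_two mg gK _ _ _ _ _ _ _ c0) => //.
- exact: measurable_union_of.
- by rewrite /union_of big_cons big_seq1.
- by rewrite {1}/union_of big_seq1; exact: union_of_disjoint.
- move=> x x'; rewrite {1}/union_of big_seq1 => Bix /union_ofP[j js Bjx'].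
  apply: ordB Bix Bjx'.
  by have /allP/(_ _ (map_f val js)) := ltis.
- case: s s0 {IH ltis ps nis us} => // j s _; rewrite big_cons.
  by rewrite addn_gt0 k0.
- by rewrite /union_of big_seq1 massB.
- exact: mass_union_of.
Qed.

Lemma merge_block_families (ss : seq (seq 'I_b)) phi y :
  (forall s, s \in ss -> s != [::] /\ pairwise ltn (map val s)) -> cvx phi ->
  avg (split_block (flatten ss)) phi y <=
  avg (flatten [seq merged_block s | s <- ss]) phi y.
Proof.
move=> + cphi; elim: ss y => //= s ss IH y h.
have mu_ := measurable_union_of.
rewrite map_cat flatten_cat !averages_cat.
have [s0 ps] := h s (mem_head _ _).
apply: le_trans (merge_block _ s0 ps _) _; first exact: (averages_cvx _ mg gK).
apply: (averages_le _ mg gK) => //; try exact: (averages_cvx _ mg gK).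
by move=> z; apply: IH => t tss; apply: h; rewrite in_cons tss orbT.
Qed.

(** The indices in [As i] all carry the label [L i]. *)
Lemma perm_labels (I : eqType) (n m : nat) (w : 'I_m -> nat)
    (As : 'I_m -> {set 'I_n}) (a : 'I_n -> 'I_m) (L : 'I_m -> I) :
  (forall i j, (j \in As i) = (a j == i)) -> (forall i, #|As i| = w i) ->
  perm_eq [seq L (a j) | j <- enum 'I_n]
          (flatten [seq nseq (w i) (L i) | i <- enum 'I_m]).
Proof.
move=> aE wE; apply/permP => p.
rewrite count_flatten -map_comp sumnE big_map big_enum /=.
rewrite count_map -sum1_count big_enum_cond/= (partition_big a xpredT)//=.
apply: eq_bigr => i _; rewrite count_nseq -wE -sum1_card mulnC big_distrl/=.
rewrite [RHS]big_mkcond [LHS]big_mkcond; apply: eq_bigr => j _ /=.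
by rewrite aE; case: eqP => [->|_]; rewrite ?andbT ?andbF//= mul1n; case: (p _).
Qed.

Variables (m : nat) (C : 'I_m -> set T) (l : 'I_m -> nat).
Hypothesis tC : trivIset setT C.
Hypothesis l0 : forall i, (0 < l i)%N.
Hypothesis massC : forall i, mass mu (C i) = c * (l i)%:R.
Hypothesis CB : forall i, exists J : set 'I_b, C i = \bigcup_(j in J) B j.
Hypothesis coverC : forall j x, B j x -> exists i, C i x.
Variables (n : nat) (Bs : 'I_b -> {set 'I_n}) (Cs : 'I_m -> {set 'I_n}).
Variables (blockB : 'I_n -> 'I_b) (blockC : 'I_n -> 'I_m).
Hypothesis BsE : forall i j, (j \in Bs i) = (blockB j == i).
Hypothesis CsE : forall i j, (j \in Cs i) = (blockC j == i).
Hypothesis cardB : forall i, #|Bs i| = k i.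
Hypothesis cardC : forall i, #|Cs i| = l i.

(** By commutation the two sides depend only on how often each block occurs, and
    the blocks of the finer partition can be grouped according to the set of the
    coarser one that contains them. The number of indices agrees in each group
    because it is proportional to the mass. *)
Lemma averages_refine phi y : cvx phi ->
  averages mu g (fun j => B (blockB j)) (enum 'I_n) phi y <=
  averages mu g (fun j => C (blockC j)) (enum 'I_n) phi y.
Proof.
move=> cphi; have mU := measurable_union_of.
have [J CJ] := choice CB.
pose L i := [seq j <- enum 'I_b | j \in J i].
have CL i : C i = union_of (L i).
  rewrite CJ; apply/seteqP; split => [x [j Jj Bjx]|x /union_ofP[j]].
    by apply/union_ofP; exists j; rewrite // mem_filter mem_enum andbT inE.
  by rewrite mem_filter => /andP[/set_mem Jj _] Bjx; exists j.
have uL i : uniq (L i) by rewrite filter_uniq ?enum_uniq.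
have wL i : (\sum_(j <- L i) k j)%N = l i.
  have := massC i; rewrite CL mass_union_of// => /(mulfI (lt0r_neq0 c0)).
  by move/eqP; rewrite eqr_nat => /eqP.
have L0 i : L i != [::].
  by apply: contraTneq (l0 i) => e; rewrite -wL e big_nil.
have pL i : pairwise ltn (map val (L i)).
  rewrite -sorted_pairwise; last exact: ltn_trans.
  have : sorted ltn (map val (enum 'I_b)) by rewrite val_enum_ord iota_ltn_sorted.
  by apply: subseq_sorted; [exact: ltn_trans|exact/map_subseq/filter_subseq].
have Bnonempty j : B j !=set0.
  apply/set0P/negP => /eqP e; have := massB j; rewrite e /mass measure0/=.
  by move/esym/eqP; rewrite mulf_eq0 (gt_eqF c0)/= pnatr_eq0 gtn_eqF.
have flL : perm_eq (flatten [seq L i | i <- enum 'I_m]) (enum 'I_b).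
  apply/allP => j _ /=; rewrite count_flatten -map_comp sumnE big_map big_enum/=.
  rewrite (count_uniq_mem _ (enum_uniq _)) mem_enum.
  have [x Bjx] := Bnonempty j; have [i Cix] := coverC Bjx.
  have jL : j \in L i.
    have := Cix; rewrite CL => /union_ofP[j' j'L Bj'x].
    by rewrite (blocks_disjoint Bjx Bj'x).
  rewrite (bigD1 i)//= count_uniq_mem// jL big1 ?addn0// => i' ii'.
  rewrite count_uniq_mem//; case: (boolP (j \in L i')) => // jL'.
  have : C i' x by rewrite CL; apply/union_ofP; exists j.
  move=> Ci'x; have : i' = i by apply: tC => //; exists x.
  by move/eqP; rewrite (negPf ii').
have -> : (fun j => B (blockB j)) = union_of \o (fun j => [:: blockB j]).
  by apply/funext => j /=; rewrite /union_of big_seq1.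
have -> : (fun j => C (blockC j)) = union_of \o (fun j => L (blockC j)).
  by apply/funext => j /=.
rewrite -!averages_map.
rewrite (averages_perm _ mg gK mU cphi
  (perm_labels (fun i => [:: i]) BsE cardB)).
rewrite (averages_perm _ mg gK mU cphi (perm_labels L CsE cardC)).
have flL' : perm_eq (split_block (enum 'I_b))
    (split_block (flatten [seq L i | i <- enum 'I_m])).
  by apply: perm_flatten; apply: perm_map; rewrite perm_sym.
rewrite (averages_perm _ mg gK mU cphi flL').
have := @merge_block_families [seq L i | i <- enum 'I_m] phi y _ cphi.
rewrite -map_comp (@eq_map _ _ _ (fun i => nseq (l i) (L i))) => [|i]; last first.
  by rewrite /= wL.
by apply => s /mapP[i _ ->].
Qed.

End refinement.

(** * Affine functions *)

Section affine.
Context d (T : measurableType d) (R : realType) (mu : probability T R).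
Variable g : T -> R.
Hypothesis mg : measurable_fun setT g.
Variable K : R.
Hypothesis gK : forall x, `|g x| <= K.
Variables (I : eqType) (A : I -> set T).
Hypothesis mA : forall i, measurable (A i).
Hypothesis A0 : forall i, 0 < mass mu (A i).

(** Averaging shifts the argument of an affine function by the mean of the
    increment. *)
Lemma average_affine i (a b y : R) :
  average mu g (A i) (fun z => a * z + b) y =
  a * (y + average mu g (A i) id 0) + b.
Proof.
have ig z : mu.-integrable (A i) (EFin \o (fun x => z + g x)).
  by apply: (cvx_integrable mu mg gK (phi := id)) => // t u w _.
have ic z : mu.-integrable (A i) (EFin \o cst z).
  exact: finite_measure_integrable_cst.
have E z : \int[mu]_(x in A i) (z + g x) =
    z * mass mu (A i) + \int[mu]_(x in A i) g x.
  have ig0 : mu.-integrable (A i) (EFin \o g).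
    by have := ig 0; apply: eq_integrable => // x _ /=; rewrite add0r.
  by rewrite (RintegralD (mA i) (ic z) ig0) Rintegral_cst.
have iag : mu.-integrable (A i) (EFin \o (fun x => a * (y + g x))).
  by have := integrableZl (mA i) a (ig y); apply: eq_integrable.
rewrite /average (RintegralD (mA i) iag (ic b)).
rewrite RintegralZl// Rintegral_cst// !E mul0r add0r -/(mass mu (A i)).
by field; exact: lt0r_neq0.
Qed.

Lemma averages_affine (s : seq I) (a b y : R) :
  averages mu g A s (fun z => a * z + b) y =
  a * (y + \sum_(i <- s) average mu g (A i) id 0) + b.
Proof.
elim: s y => [|i s IH] y; first by rewrite big_nil addr0.
rewrite /= -/(averages _ _ _ _ _) (funext IH) big_cons.
rewrite (_ : (fun z => _) =
    fun z => a * z + (a * (\sum_(j <- s) average mu g (A j) id 0) + b)).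
  by rewrite average_affine; ring.
by apply/funext => z; ring.
Qed.

End affine.

(** * Sums of independent variables *)

Section independence.
Context d (T : measurableType d) (R : realType) (Q : probability T R).

(** Both sides are finite measures in [E], and rectangles form a generating
    family stable under intersection. *)
Lemma rectangle_independent (X Y : T -> R) (E0 : set T) :
  measurable E0 -> measurable_fun setT X -> measurable_fun setT Y ->
  (forall A D, measurable A -> measurable D ->
    Q (E0 `&` (X @^-1` A `&` Y @^-1` D)) =
    (Q E0 * Q (X @^-1` A `&` Y @^-1` D))%E) ->
  forall E : set (R * R), measurable E ->
    Q (E0 `&` (fun w => (X w, Y w)) @^-1` E) =
    (Q E0 * Q ((fun w => (X w, Y w)) @^-1` E))%E.
Proof.
move=> mE0 mX mY rect E mE.
set Z := fun w => (X w, Y w).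
have mZ : measurable_fun setT Z by exact: measurable_fun_pair.
pose m1 : {measure set (R * R) -> \bar R} :=
  measure_function_pushforward__canonical__measure_function_Measure
    (mrestr Q mE0) mZ.
have r0 : 0 <= fine (Q E0) by rewrite fine_ge0.
pose m2 : {measure set (R * R) -> \bar R} := mscale (NngNum r0)
  (measure_function_pushforward__canonical__measure_function_Measure Q mZ).
have m1E F : m1 F = Q (E0 `&` Z @^-1` F).
  by rewrite /m1/= /pushforward/= /mrestr setIC.
have m2E F : m2 F = (Q E0 * Q (Z @^-1` F))%E.
  by rewrite /m2/= /mscale/= fineK// fin_num_measure.
rewrite -m1E -m2E.
apply: (measure_unique [set A `*` B | A in measurable & B in measurable]
  (fun=> setT)) => //.
- by rewrite measurable_prod_measurableType.
- move=> _ _ [A mA [B mB <-]] [A' mA' [B' mB' <-]].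
  exists (A `&` A'); first exact: measurableI.
  by exists (B `&` B'); [exact: measurableI|rewrite setXI].
- by move=> _; exists setT => //; exists setT => //; rewrite setXTT.
- by rewrite bigcup_const.
- by move=> _ [A mA [B mB <-]]; rewrite m1E m2E; exact: rect.
- move=> _; rewrite m1E; apply: le_lt_trans (ltry 1).
  by apply: probability_le1; rewrite preimage_setT setIT.
Qed.

(** The joint law is the product of the marginals, and Tonelli applies. *)
Lemma integral_independent (X Y : {RV Q >-> R}) (h : R * R -> \bar R) :
  (forall A D, measurable A -> measurable D ->
    Q (X @^-1` A `&` Y @^-1` D) = (Q (X @^-1` A) * Q (Y @^-1` D))%E) ->
  measurable_fun setT h -> (forall z, (0 <= h z)%E) ->
  (\int[Q]_w h (X w, Y w) =
   \int[Q]_w \int[distribution Q X]_x h (x, Y w))%E.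
Proof.
move=> XY mh h0.
have mZ : measurable_fun setT (fun w => (X w, Y w)).
  by exact: measurable_fun_pair.
transitivity (\int[pushforward Q (fun w => (X w, Y w))]_z h z)%E.
  by rewrite ge0_integral_pushforward.
transitivity (\int[distribution Q X \x distribution Q Y]_z h z)%E.
  apply: eq_measure_integral => A mA _.
  apply/esym; apply: (product_measure_unique
    (m' := measure_function_pushforward__canonical__measure_function_Measure Q mZ)) => //.
rewrite (fubini_tonelli2 h mh h0).
rewrite ge0_integral_distribution//; last by move=> y; apply: integral_ge0.
exact: measurable_fun_fubini_tonelli_G.
Qed.

Context (I : finType) (X : I -> {RV Q >-> R}).
Hypothesis indep : mutually_independent X.
Variable g : I -> R -> R.
Hypothesis mg : forall i, measurable_fun setT (g i).

Let S (s : seq I) w := \sum_(i <- s) g i (X i w).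

Lemma measurable_partial_sum s : measurable_fun setT (S s).
Proof.
apply: measurable_sum => i.
exact: (measurableT_comp (mg i)).
Qed.

Lemma measurable_event (J : {set I}) (A : I -> set R) :
  (forall i, measurable (A i)) ->
  measurable (\bigcap_(i in [set` J]) (X i @^-1` A i)).
Proof.
move=> mA; apply: fin_bigcap_measurable => // i _.
by rewrite -[X in measurable X]setTI; exact: measurable_funPT.
Qed.

(** Grouping property of independence. Keeping an arbitrary event of the
    variables outside [s] is what makes the induction go through: the next variable
    is taken out of that event and paired with the sum. *)
Lemma partial_sum_independent s (J : {set I}) (A : I -> set R) (D : set R) :
  uniq s -> (forall i, i \in s -> i \notin J) ->
  (forall i, measurable (A i)) -> measurable D ->
  Q (\bigcap_(i in [set` J]) (X i @^-1` A i) `&` S s @^-1` D) =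
  (Q (\bigcap_(i in [set` J]) (X i @^-1` A i)) * Q (S s @^-1` D))%E.
Proof.
elim: s J A D => [|i s IH] J A D /=.
  move=> _ _ mA mD; have -> : S [::] = cst 0.
    by apply/funext => w; rewrite /S big_nil.
  rewrite preimage_cst; case: ifP => _.
    by rewrite setIT probability_setT mule1.
  by rewrite setI0 measure0 mule0.
move=> /andP[nis us] sJ mA mD.
have iJ : i \notin J by apply: sJ; rewrite mem_head.
(* The event [X i in F] is first absorbed into the family over [i |: J'], to which
   the induction hypothesis applies. *)
have IHi (J' : {set I}) (F : set R) (G : set R) : (forall j, j \in s -> j \notin J') ->
    i \notin J' -> measurable F -> measurable G ->
    Q (\bigcap_(j in [set` J']) (X j @^-1` A j) `&`
       (X i @^-1` F `&` S s @^-1` G)) =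
    (Q (\bigcap_(j in [set` J']) (X j @^-1` A j)) * Q (X i @^-1` F) *
     Q (S s @^-1` G))%E.
  move=> sJ' iJ' mF mG.
  pose A' j := if j == i then F else A j.
  have mA' j : measurable (A' j) by rewrite /A'; case: ifP.
  have capE : \bigcap_(j in [set` J']) (X j @^-1` A j) `&` X i @^-1` F =
      \bigcap_(j in [set` (i |: J')%SET]) (X j @^-1` A' j).
    apply/seteqP; split => [w [wJ wF] j /=|w wJ].
      rewrite in_setU1 /A' => /predU1P[->|jJ]; first by rewrite eqxx.
      by case: eqP => [->//|_]; exact: wJ.
    split=> [j /= jJ|].
      have := wJ j; rewrite /= in_setU1 jJ orbT /A' => /(_ isT).
      by rewrite (_ : (j == i) = false)//; apply: contraNF iJ' => /eqP <-.
    by have := wJ i; rewrite /= setU11 /A' eqxx => /(_ isT).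
  rewrite setIA capE IH//; last first.
    move=> j js; rewrite in_setU1 negb_or sJ'// andbT.
    by apply: contraNneq nis => <-.
  congr (_ * _)%E; rewrite !indep// big_setU1//= muleC; congr (_ * _)%E.
    apply: eq_bigr => j jJ; rewrite /A'.
    by rewrite (_ : (j == i) = false)//; apply: contraNF iJ' => /eqP <-.
  by rewrite /A' eqxx.
have SE : S (i :: s) @^-1` D =
    (fun w => ((X i w : R), S s w)) @^-1` [set z | D (g i z.1 + z.2)].
  by apply/seteqP; split => w /=; rewrite /S big_cons.
rewrite !SE; apply: rectangle_independent => //.
- exact: measurable_event.
- exact: measurable_partial_sum.
- move=> F G mF mG; rewrite IHi//; last first.
    by move=> j js; apply: sJ; rewrite in_cons js orbT.
  have := IHi finset.set0 F G; rewrite [X in \bigcap_(_ in X) _](_ : _ = set0).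
    rewrite bigcap_set0 setTI probability_setT mul1e => -> //.
    - by rewrite muleA.
    - by move=> j; rewrite finset.in_set0.
    - by rewrite finset.in_set0.
  by apply/seteqP; split => j //=; rewrite finset.in_set0.
- rewrite -[X in measurable X]setTI.
  have : measurable_fun setT (fun z : R * R => g i z.1 + z.2).
    by apply: measurable_funD => //; exact: (measurableT_comp (mg i)).
  by apply.
Qed.

Definition shift_mean (i : I) (h : R -> \bar R) (y : R) : \bar R :=
  (\int[distribution Q (X i)]_x h (y + g i x)%R)%E.

Lemma measurable_shift_mean i h : measurable_fun setT h ->
  (forall y, (0 <= h y)%E) -> measurable_fun setT (shift_mean i h).
Proof.
move=> mh h0.
apply: (measurable_fun_fubini_tonelli_F (m2 := distribution Q (X i))
  (fun z : R * R => h (z.1 + g i z.2))) => //.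
apply: (measurableT_comp mh).
by apply: measurable_funD => //; exact: (measurableT_comp (mg i)).
Qed.

(** The head of the list is integrated first, hence is the innermost operator. *)
Lemma integral_independent_sum s h : uniq s -> measurable_fun setT h ->
  (forall y, (0 <= h y)%E) ->
  (\int[Q]_w h (S s w) = foldl (fun h i => shift_mean i h) h s 0%R)%E.
Proof.
elim: s h => [|i s IH] h /=.
  move=> _ mh h0; rewrite /S.
  under eq_integral do rewrite big_nil.
  rewrite integral_cst// [X in (_ * X)%E](_ : _ = 1%E) ?mule1//.
  exact: probability_setT.
move=> /andP[nis us] mh h0.
rewrite -IH//; last 2 first.
  exact: measurable_shift_mean.
  by move=> y; apply: integral_ge0.
under eq_integral do rewrite /S big_cons -/(S s _) addrC.
pose Y : {RV Q >-> R} := mfun_Sub (mem_set (measurable_partial_sum s)).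
have /= := @integral_independent (X i) Y (fun z => h (z.2 + g i z.1)).
apply => //.
- move=> A D mA mD.
  have := @partial_sum_independent s [set i]%SET (fun=> A) D us.
  rewrite (_ : [set` [set i]%SET] = [set i]); last first.
    by apply/seteqP; split => j /=; rewrite finset.in_set1 => /eqP.
  by rewrite bigcap_set1; apply => // j js; rewrite finset.in_set1;
    apply: contraNneq nis => <-.
- apply: (measurableT_comp mh).
  by apply: measurable_funD => //; exact: (measurableT_comp (mg i)).
Qed.

End independence.

(** * Two facts on integrals *)

(** When [p] has infinite expectation, so has the positive part of [p + a], while
    the negative part is dominated by that of [a]. *)
Lemma expectation_add_integrable d (T : measurableType d) (R : realType)
    (Q : probability T R) (p a : T -> R) :
  measurable_fun setT p -> (forall w, 0 <= p w) ->
  Q.-integrable setT (EFin \o a) ->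
  (\int[Q]_w (p w + a w)%:E = \int[Q]_w (p w)%:E + \int[Q]_w (a w)%:E)%E.
Proof.
move=> mp p0 ia.
have ma : measurable_fun setT a.
  by apply/measurable_EFinP; exact: measurable_int ia.
have mEp : measurable_fun setT (EFin \o p) by exact/measurable_EFinP.
have a_fin := integrable_fin_num measurableT ia.
have [ip|] := ltP (\int[Q]_w (p w)%:E)%E +oo%E.
  rewrite -integralD//.
  apply/integrableP; split => //.
  by under eq_integral do rewrite /= ger0_norm//.
rewrite leye_eq => /eqP pE; rewrite pE addye; last first.
  by move: a_fin; case: (integral _ _ _).
have mpa : measurable_fun setT (fun w => (p w + a w)%:E).
  by apply/measurable_EFinP; exact: measurable_funD.
have neg_fin : (\int[Q]_w (fun w => (p w + a w)%:E)^\- w < +oo)%E.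
  apply: le_lt_trans (integral_funeneg_lt_pinfty measurableT ia).
  have mEa : measurable_fun setT (EFin \o a) by exact/measurable_EFinP.
  apply: ge0_le_integral => //; try exact: measurable_funeneg mpa;
    try exact: measurable_funeneg mEa.
  move=> w _; rewrite !funenegE /= -!EFin_max lee_fin.
  by rewrite ge_max !le_max lexx orbT andbT lerN2 lerDr p0.
rewrite integralE.
suff -> : (\int[Q]_w (fun w => (p w + a w)%:E)^\+ w = +oo)%E.
  rewrite addye//; move: neg_fin.
  by case: (\int[Q]_w (fun w => (p w + a w)%:E)^\- w)%E.
apply/eqP; rewrite -leye_eq -pE.
have : (\int[Q]_w (p w)%:E <=
    \int[Q]_w ((fun w => (p w + a w)%:E)^\+ w + (EFin \o a)^\- w))%E.
  apply: ge0_le_integral => //.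
    by move=> x _; rewrite lee_fin.
    by apply: emeasurable_funD; [exact: measurable_funepos|
      apply: measurable_funeneg; exact/measurable_EFinP].
  move=> w _; rewrite funeposE funenegE /= -!EFin_max -EFinD lee_fin.
  by rewrite -[leLHS](addrK (a w)) lerD// le_max lexx.
rewrite ge0_integralD//; try exact: measurable_funepos;
  try by apply: measurable_funeneg; exact/measurable_EFinP.
have := integral_funeneg_lt_pinfty measurableT ia; rewrite pE.
case: (\int[Q]_w (fun w => (p w + a w)%:E)^\+ w)%E => [r||] //.
have : (0 <= \int[Q]_w (EFin \o a)^\- w)%E by apply: integral_ge0.
by case: (\int[Q]_w (EFin \o a)^\- w)%E.
Qed.

(** [nu] does not charge the complement of [B] and is a multiple of [mu] on
    [B]. *)
Lemma integral_cond_law d (T : measurableType d) (R : realType)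
    (mu nu : probability T R) (B : set T) (h : T -> R) :
  measurable B -> 0 < mass mu B ->
  (forall A, measurable A -> nu A = (mu (A `&` B) / mu B)%E) ->
  measurable_fun setT h -> mu.-integrable B (EFin \o h) ->
  (\int[nu]_x (h x)%:E)%E = ((\int[mu]_(x in B) h x) / mass mu B)%:E.
Proof.
move=> mB B0 nuE mh ih.
have i0 : 0 <= (mass mu B)^-1 by rewrite invr_ge0 ltW.
have {}nuE A : measurable A -> nu A = ((mass mu B)^-1%:E * mu (A `&` B))%E.
  by move=> mA; rewrite nuE// (massE _ mB) inver gt_eqF// muleC.
have mEh D : measurable D -> measurable_fun D (EFin \o h).
  by move=> mD; apply: measurable_funS (measurableT) _ _ => //; exact/measurable_EFinP.
have mBC : measurable (~` B) by exact: measurableC.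
rewrite -(setUv B) integral_setU//; last 2 first.
- by rewrite setUv; exact: mEh.
- by apply/disj_set2P; exact: setICr.
rewrite [X in (_ + X)%E]null_set_integral ?adde0//; last 2 first.
- exact: mEh.
- by apply: etrans (nuE _ mBC) _; rewrite setICl measure0 mule0.
rewrite (eq_measure_integral (mscale (NngNum i0) mu)); last first.
  by move=> A mA AB; apply: etrans (nuE A mA) _; rewrite setIidl.
rewrite integralE !ge0_integral_mscale//=; last 2 first.
- exact/measurable_funeneg/mEh.
- exact/measurable_funepos/mEh.
rewrite -muleBr//; last exact: integrable_add_def.
by rewrite -integralE /Rintegral mulrC EFinM fineK// integrable_fin_num.
Qed.

(** * The estimator of one partition *)

Section noise.
Context {R : realType} (nu : probability R R) (r : R).

(** Extended values are needed here, as [phi] may fail to be integrable against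
    the law of the noise. *)
Definition noise_mean (h : R -> \bar R) (y : R) : \bar R :=
  (\int[nu]_x h (y + r * x)%R)%E.

Lemma measurable_noise_mean h : measurable_fun setT h ->
  (forall y, (0 <= h y)%E) -> measurable_fun setT (noise_mean h).
Proof.
move=> mh h0.
apply: (measurable_fun_fubini_tonelli_F (m2 := nu)
  (fun z : R * R => h (z.1 + r * z.2))) => //.
apply: (measurableT_comp mh).
by apply: measurable_funD => //; exact: measurable_funM.
Qed.

Lemma noise_mean_le h h' : measurable_fun setT h -> measurable_fun setT h' ->
  (forall y, (0 <= h y)%E) -> (forall y, (h y <= h' y)%E) ->
  forall y, (noise_mean h y <= noise_mean h' y)%E.
Proof.
move=> mh mh' h0 hh' y; apply: ge0_le_integral => //.
- by apply: (measurableT_comp mh); apply: measurable_funD => //;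
    exact: measurable_funM.
- by apply: (measurableT_comp mh'); apply: measurable_funD => //;
    exact: measurable_funM.
Qed.

Lemma iter_noise_mean_le m h h' : measurable_fun setT h -> measurable_fun setT h' ->
  (forall y, (0 <= h y)%E) -> (forall y, (h y <= h' y)%E) ->
  forall y, (iter m noise_mean h y <= iter m noise_mean h' y)%E.
Proof.
move=> mh mh' h0 hh'.
have h'0 y : (0 <= h' y)%E by exact: le_trans (hh' y).
have mi k : measurable_fun setT k -> (forall y, (0 <= k y)%E) -> forall m,
    measurable_fun setT (iter m noise_mean k) /\ forall y, (0 <= iter m noise_mean k y)%E.
  move=> mk k0; elim=> //= {}m [IH1 IH2]; split; first exact: measurable_noise_mean.
  by move=> y; apply: integral_ge0.
elim: m => //= m IH; apply: noise_mean_le IH.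
- exact: (mi _ mh h0 m).1.
- exact: (mi _ mh' h'0 m).1.
- exact: (mi _ mh h0 m).2.
Qed.

End noise.

Section sample.
Context (R : realType) (mu nu : probability R R) (g : R -> R).
Hypothesis mg : measurable_fun setT g.
Variable K : R.
Hypothesis gK : forall x, `|g x| <= K.
Hypothesis inu : nu.-integrable setT EFin.
Variables (n : nat) (D : 'I_n -> set R) (r : R).
Hypothesis mD : forall j, measurable (D j).
Hypothesis D0 : forall j, 0 < mass mu (D j).
Context d (T : measurableType d) (Q : probability T R).
Variables V e : 'I_n -> {RV Q >-> R}.
Hypothesis lawV : forall j A, measurable A ->
  distribution Q (V j) A = (mu (A `&` D j) / mu (D j))%E.
Hypothesis lawe : forall j A, measurable A -> distribution Q (e j) A = nu A.
Hypothesis indep : mutually_independent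
  (fun s : 'I_n + 'I_n => match s with inl j => V j | inr j => e j end).

Definition estimator (w : T) : R := \sum_(j < n) (g (V j w) + r * e j w).

Lemma integral_V j psi y : cvx psi ->
  (\int[distribution Q (V j)]_x (psi (y + g x))%:E)%E =
  (average mu g (D j) psi y)%:E.
Proof.
move=> cpsi; apply: integral_cond_law => //.
- exact: lawV.
- apply: (measurableT_comp (cvx_measurable cpsi)).
  exact: measurable_funD.
- exact: (cvx_integrable mu mg gK).
Qed.

Lemma integral_e j (h : R -> \bar R) :
  (\int[distribution Q (e j)]_x h x = \int[nu]_x h x)%E.
Proof. by apply: eq_measure_integral => A mA _; exact: lawe. Qed.

Lemma measurable_estimator : measurable_fun setT estimator.
Proof.
apply: measurable_sum => j; apply: measurable_funD.
  exact: (measurableT_comp mg).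
exact: measurable_funM.
Qed.

(** The increments coming from [V] are integrated first: there the integrals are
    finite and [averages] applies, and what remains is the noise. *)
Lemma expectation_estimator phi : cvx phi -> (forall x, 0 <= phi x) ->
  (\int[Q]_w (phi (estimator w))%:E =
   iter n (noise_mean nu r) (EFin \o averages mu g D (enum 'I_n) phi) 0%R)%E.
Proof.
move=> cphi phi0.
pose X (s : 'I_n + 'I_n) : {RV Q >-> R} :=
  match s with inl j => V j | inr j => e j end.
pose G (s : 'I_n + 'I_n) : R -> R := if s is inl _ then g else fun x => r * x.
have mG s : measurable_fun setT (G s).
  by case: s => j //=; exact: measurable_funM.
(* The list is reversed so that the left fold over the independent variables
   becomes the right fold that defines [averages]. *)
pose l : seq ('I_n + 'I_n) := map inl (rev (enum 'I_n)) ++ map inr (enum 'I_n).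
have ul : uniq l.
  rewrite cat_uniq !map_inj_uniq; [|by move=> ? ? []..].
  rewrite rev_uniq -enumT !enum_uniq andbT andTb; apply/hasPn => _ /mapP[j _ ->].
  by apply/mapP => -[].
have mphi : measurable_fun setT (EFin \o phi).
  by apply/measurable_EFinP; exact: cvx_measurable.
have := integral_independent_sum (X := X) indep mG ul mphi.
rewrite /= => /(_ (fun y => phi0 y)).
have -> : (fun w => (phi (\sum_(i <- l) G i (X i w)))%:E) =
    (fun w => (phi (estimator w))%:E).
  apply/funext => w; rewrite big_cat !big_map /=.
  rewrite (perm_big (enum 'I_n)) ?perm_rev//= !big_enum/=.
  by rewrite /estimator big_split.
move=> ->; rewrite foldl_cat.
have -> : foldl (fun h i => shift_mean X G i h)
    (EFin \o phi) (map inl (rev (enum 'I_n))) =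
    EFin \o averages mu g D (enum 'I_n) phi.
  elim: (enum 'I_n) => //= j s IH.
  rewrite rev_cons map_rcons foldl_rcons IH; apply/funext => y.
  by rewrite /shift_mean/= integral_V//; exact: (averages_cvx _ mg gK).
have -> (s : seq 'I_n) h :
    foldl (fun h i => shift_mean X G i h) h (map inr s) =
    iter (size s) (noise_mean nu r) h.
  elim: s h => //= j s IH h; rewrite IH -iterS iterSr; congr (iter _ _ _).
  by apply/funext => y; rewrite /shift_mean/= integral_e.
by rewrite size_enum_ord.
Qed.

Lemma integrable_gV j : Q.-integrable setT (EFin \o (fun w => g (V j w))).
Proof.
apply: measurable_bounded_integrable => //.
- by rewrite -ge0_fin_numE ?measure_ge0 ?fin_num_measure.
- exact: (measurableT_comp mg).
- exists K; split; first exact: num_real.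
  by move=> z Kz w _ /=; exact: le_trans (gK _) (ltW Kz).
Qed.

Lemma integrable_e j : Q.-integrable setT (EFin \o e j).
Proof.
apply/integrableP; split; first exact/measurable_EFinP.
have /integrableP[_] := inu; rewrite -(integral_e j) ge0_integral_distribution//.
by apply/measurableT_comp => //; exact/measurable_EFinP.
Qed.

Lemma integrable_re j : Q.-integrable setT (EFin \o (fun w => r * e j w)).
Proof.
have := integrableZl measurableT r (integrable_e j).
by apply: eq_integrable => // w _; rewrite /= EFinM.
Qed.

Lemma integrable_estimator : Q.-integrable setT (EFin \o estimator).
Proof.
have := @integrable_sum _ _ _ Q setT measurableT 'I_n (enum 'I_n) xpredT
  (fun j w => (g (V j w) + r * e j w)%:E).
have -> : EFin \o estimator =
    (fun w => \sum_(j <- enum 'I_n) (g (V j w) + r * e j w)%:E)%E.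
  by apply/funext => w /=; rewrite /estimator sumEFin big_enum.
apply=> j _; have := integrableD measurableT (integrable_gV j) (integrable_re j).
by apply: eq_integrable => // w _; rewrite /= EFinD.
Qed.

Lemma mean_estimator : (\int[Q]_w (estimator w)%:E =
  (\sum_(j <- enum 'I_n) average mu g (D j) id 0 +
   \sum_(j <- enum 'I_n) r * \int[nu]_x x)%:E)%E.
Proof.
rewrite -big_split -sumEFin.
under eq_integral do rewrite /estimator -big_enum -sumEFin.
rewrite integral_sum//; last first.
  move=> j; have := integrableD measurableT (integrable_gV j) (integrable_re j).
  by apply: eq_integrable => // w _; rewrite /= EFinD.
apply: eq_bigr => j _; rewrite EFinD.
under eq_integral do rewrite EFinD.
rewrite integralD//; [|exact: integrable_gV|exact: integrable_re].
congr (_ + _)%E.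
- rewrite -integral_V//.
  rewrite integral_distribution//.
  + by apply: eq_integral => w _ /=; rewrite add0r.
  + by apply/measurable_EFinP; exact: measurable_funD.
  + have := integrable_gV j; apply: eq_integrable => // w _ /=.
    by rewrite add0r.
- under eq_integral do rewrite EFinM.
  rewrite integralZl//; last exact: integrable_e.
  rewrite EFinM; congr (_ * _)%E.
  rewrite /Rintegral fineK; last exact: integrable_fin_num.
  rewrite -(integral_e j) integral_distribution//.
  exact: integrable_e.
Qed.

End sample.

(** * Comparison of the two estimators *)

Lemma associated_block (n b : nat) (k : 'I_b -> nat) (Bs : 'I_b -> {set 'I_n}) :
  associated k Bs ->
  exists block : 'I_n -> 'I_b, forall i j, (j \in Bs i) = (block j == i).
Proof.
move=> [dis cov _]; have [block blockP] := choice cov.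
exists block => i j; apply/idP/eqP => [jB|<-//].
apply/eqP/contraT => /dis/setP/(_ j).
by rewrite !finset.inE blockP jB.
Qed.

Lemma mass_admissible d (T : measurableType d) (R : realType)
    (P : probability T R) (U : {RV P >-> R}) (n b : nat)
    (B : 'I_b -> set R) (k : 'I_b -> nat) (i : 'I_b) :
  admissible U n B k -> mass (distribution P U) (B i) = n%:R^-1 * (k i)%:R.
Proof.
move=> [_ _ _ /(_ i)[_ BE] _].
by rewrite /mass/= /distribution/pushforward BE/= mulrC.
Qed.

Lemma W_IE_estimator (R : realType) (f g : R -> R) (n b : nat)
    (Bs : 'I_b -> {set 'I_n}) (block : 'I_n -> 'I_b)
    d (T : measurableType d) (Q : probability T R) (V e : 'I_n -> {RV Q >-> R}) :
  (forall i j, (j \in Bs i) = (block j == i)) ->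
  (forall j w, g (V j w) = n%:R^-1 * f (V j w)) ->
  W_IE f Bs V e = estimator g n%:R^-1 V e.
Proof.
move=> blockE gE; apply/funext => w; rewrite /W_IE /estimator.
rewrite (partition_big block xpredT)//= mulr_sumr; apply: eq_bigr => i _.
rewrite mulr_sumr; apply: eq_big => [j|j _]; first by rewrite blockE.
by rewrite mulrDr gE.
Qed.

Theorem theorem4p4 (R : realType)
  (* U and eps *)
  (d : measure_display) (T : measurableType d) (P : probability T R)
  (U eps : {RV P >-> R})
  (hU : forall w, U w \in `[0, 1]%R)
  (hUna : non_atomic (distribution P U))
  (heps_int : P.-integrable setT (EFin \o eps))
  (heps_mean : ('E_P[eps] = 0)%E)
  (heps_var : ('V_P[eps] < +oo)%E)
  (n : nat) (hn : (1 <= n)%N)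
  (* the partitions B and C *)
  (b : nat) (B : 'I_b -> set R) (kB : 'I_b -> nat) (Bs : 'I_b -> {set 'I_n})
  (hB : admissible U n B kB) (hBs : associated kB Bs)
  (c : nat) (C : 'I_c -> set R) (kC : 'I_c -> nat) (Cs : 'I_c -> {set 'I_n})
  (hC : admissible U n C kC) (hCs : associated kC Cs)
  (hBmon : monotone_partition B) (hCmon : monotone_partition C)
  (href : coarser C B)
  (f : R -> R)
  (hf : {in `[0, 1]%R &, {homo f : x y / x <= y}})
  (* realizations of the variables defining the two estimators *)
  (dB : measure_display) (TB : measurableType dB) (PB : probability TB R)
  (VB eB : 'I_n -> {RV PB >-> R})
  (hVB : IE_sample U eps B Bs VB eB)
  (dC : measure_display) (TC : measurableType dC) (PC : probability TC R)
  (VC eC : 'I_n -> {RV PC >-> R})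
  (hVC : IE_sample U eps C Cs VC eC) :
  convex_order PB PC (W_IE f Bs VB eB) (W_IE f Cs VC eC).
Proof.
have [mB tB coverB kB_bounds _] := hB.
have [mC tC coverC kC_bounds _] := hC.
have [blockB blockBE] := associated_block hBs.
have [blockC blockCE] := associated_block hCs.
have [_ _ cardB] := hBs; have [_ _ cardC] := hCs.
have [VB01 lawVB lawEB indepB] := hVB.
have [VC01 lawVC lawEC indepC] := hVC.
pose mu : probability _ R := distribution P U.
pose nu : probability _ R := distribution P eps.
have n0 : 0 < n%:R^-1 :> R by rewrite invr_gt0 ltr0n.
(* Only the values of [f] on [0, 1] are known to be monotone; composing with the
   projection onto [0, 1] gives a monotone function on the whole line. *)
pose clamp (x : R) := Num.max 0 (Num.min x 1).
have clamp01 x : clamp x \in `[0, 1]%R.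
  by rewrite in_itv/= le_max lexx/= ge_max ler01 ge_min lexx orbT.
have clampE x : x \in `[0, 1]%R -> clamp x = x.
  by rewrite in_itv/= => /andP[x0 x1]; rewrite /clamp min_l// max_r.
pose g x := n%:R^-1 * f (clamp x).
have g_nd : {homo g : x y / x <= y}.
  move=> x y xy; apply: ler_wpM2l; [exact: ltW|apply: hf => //].
  rewrite /clamp ge_max !le_max lexx/=; apply/orP; right.
  by rewrite le_min !ge_min xy lexx orbT.
have mg : measurable_fun setT g by exact: nondecreasing_measurable.
have g01 x : g 0 <= g x <= g 1.
  have cl y : g (clamp y) = g y by rewrite /g (clampE (clamp y)).
  by rewrite -(cl x); have := clamp01 x; rewrite in_itv/= => /andP[? ?];
    rewrite !g_nd.
have gK x : `|g x| <= `|g 0| + `|g 1|.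
  have /andP[g0 g1] := g01 x; rewrite ler_norml.
  have := ler_norm (g 1); have := ler_norm (- g 0); rewrite normrN.
  have := normr_ge0 (g 0); have := normr_ge0 (g 1).
  by move=> ? ? ? ?; apply/andP; split; lra.
have massB i : mass mu (B i) = n%:R^-1 * (kB i)%:R by exact: mass_admissible hB.
have massC i : mass mu (C i) = n%:R^-1 * (kC i)%:R by exact: mass_admissible hC.
have kB0 i : (0 < kB i)%N by have [/andP[]] := kB_bounds i.
have kC0 i : (0 < kC i)%N by have [/andP[]] := kC_bounds i.
have massB0 j : 0 < mass mu (B (blockB j)) by rewrite massB mulr_gt0// ltr0n.
have massC0 j : 0 < mass mu (C (blockC j)) by rewrite massC mulr_gt0// ltr0n.
have inu : nu.-integrable setT EFin.
  apply/integrableP; split; first exact/measurable_EFinP.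
  have /integrableP[_] := heps_int; apply: le_lt_trans.
  by rewrite ge0_integral_distribution//; exact: measurableT_comp.
have lawV_of b' (B' : 'I_b' -> set R) (block : 'I_n -> 'I_b') d' (T' : measurableType d')
    (Q : probability T' R) (V : 'I_n -> {RV Q >-> R})
    (Bs' : 'I_b' -> {set 'I_n}) :
    (forall i j, (j \in Bs' i) = (block j == i)) ->
    (forall i (j : 'I_n), j \in Bs' i -> forall A, measurable A ->
      distribution Q (V j) A = cond_law U (B' i) A) ->
    forall j A, measurable A ->
      distribution Q (V j) A = (mu (A `&` B' (block j)) / mu (B' (block j)))%E.
  by move=> BE h j A mA; rewrite (h (block j))// BE eqxx.
have lawB := lawV_of _ _ _ _ _ _ _ _ blockBE lawVB.
have lawC := lawV_of _ _ _ _ _ _ _ _ blockCE lawVC.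
have -> : W_IE f Bs VB eB = estimator g n%:R^-1 VB eB.
  by apply: W_IE_estimator blockBE _ => j w; rewrite /g clampE.
have -> : W_IE f Cs VC eC = estimator g n%:R^-1 VC eC.
  by apply: W_IE_estimator blockCE _ => j w; rewrite /g clampE.
have intB := integrable_estimator mg gK inu n%:R^-1 VB lawEB.
have intC := integrable_estimator mg gK inu n%:R^-1 VC lawEC.
pose DB j := B (blockB j); pose DC j := C (blockC j).
have mDB j : measurable (DB j) by exact: mB.
have mDC j : measurable (DC j) by exact: mC.
have refine psi y : cvx psi -> averages mu g DB (enum 'I_n) psi y <=
    averages mu g DC (enum 'I_n) psi y.
  apply: (averages_refine mg gK mB tB n0 kB0 massB) => //.
  - by move=> i j ij x x' Bx Bx'; apply: g_nd; exact: hBmon ij _ _ Bx Bx'.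
  - move=> j x Bjx; have : (\bigcup_i C i) x by rewrite coverC -coverB; exists j.
    by move=> [i _ Cix]; exists i.
(* The comparison of averages for the convex functions [z] and [-z]. *)
have mean_eq : \sum_(j <- enum 'I_n) average mu g (DB j) id 0 =
    \sum_(j <- enum 'I_n) average mu g (DC j) id 0.
  have := refine _ 0 (cvx_affine (-1) 0); have := refine _ 0 (cvx_affine 1 0).
  rewrite !(averages_affine mg gK)// !add0r !addr0 !mul1r !mulN1r lerN2.
  by move=> le1 le2; apply/eqP; rewrite eq_le le1 le2.
have expectE : (\int[PB]_w (estimator g n%:R^-1 VB eB w)%:E =
    \int[PC]_w (estimator g n%:R^-1 VC eC w)%:E)%E.
  rewrite (mean_estimator mg gK inu _ _ massB0 lawB lawEB)//.
  rewrite (mean_estimator mg gK inu _ _ massC0 lawC lawEC)//.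
  by rewrite -/DB -/DC mean_eq.
split => // phi /convex_function_cvx cphi.
have [a [a' minor]] := cvx_affine_minorant cphi.
(* Subtracting an affine minorant leaves a nonnegative convex function. *)
pose p x := phi x + (- a * x + - a').
have cp : cvx p by apply: cvxD => //; exact: cvx_affine.
have p0 x : 0 <= p x by have := minor x; rewrite /p; lra.
have phiE x : phi x = p x + (a * x + a') by rewrite /p; ring.
rewrite unlock /=.
have splitE d' (T' : measurableType d') (Q : probability T' R) (W : T' -> R) :
    measurable_fun setT W -> Q.-integrable setT (EFin \o W) ->
    (\int[Q]_w (phi (W w))%:E =
     \int[Q]_w (p (W w))%:E + (a%:E * \int[Q]_w (W w)%:E + a'%:E))%E.
  move=> mW iW.
  have iaW : Q.-integrable setT (EFin \o (fun w => a * W w)).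
    by have := integrableZl measurableT a iW; apply: eq_integrable.
  have ia' : Q.-integrable setT (EFin \o cst a').
    exact: finite_measure_integrable_cst.
  under eq_integral do rewrite phiE.
  rewrite expectation_add_integrable//.
  - under [X in (_ + X)%E]eq_integral do rewrite EFinD.
    rewrite integralD//; under [X in (_ + (X + _))%E]eq_integral do rewrite EFinM.
    rewrite integralZl//; congr (_ + (_ + _))%E.
    rewrite integral_cst// [X in (_ * X)%E](_ : _ = 1%E) ?mule1//.
    exact: probability_setT.
  - exact: (measurableT_comp (cvx_measurable cp)).
  - by have := integrableD measurableT iaW ia'; apply: eq_integrable.
rewrite !splitE//; try exact: measurable_estimator.
rewrite expectE leeD2r//.
rewrite (expectation_estimator mg gK _ _ massB0 lawB lawEB indepB cp p0)//.
rewrite (expectation_estimator mg gK _ _ massC0 lawC lawEC indepC cp p0)//.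
have cav D : (forall j : 'I_n, measurable (D j)) ->
    measurable_fun setT (EFin \o averages mu g D (enum 'I_n) p).
  move=> mD; apply/measurable_EFinP; apply: cvx_measurable.
  by apply: (averages_cvx _ mg gK) => //.
apply: iter_noise_mean_le => //.
- exact: cav mDB.
- exact: cav mDC.
- by move=> y; rewrite lee_fin; exact: averages_ge0.
- by move=> y; rewrite lee_fin; exact: refine.
Qed.
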